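(* Let $(\mathcal X,\rho)$ be a separable metric space with base point $\mathrm e\in\mathcal X$, let $\kappa:\mathcal X\times\mathcal X\to\mathbb R$ be an $(L,\rho)$-Lipschitz kernel, and let $(\mathcal H,\|\cdot\|_{\mathcal H})$ be the corresponding reproducing kernel Hilbert space. Let $\Theta$ be the set of all finite tuples $\theta=((a_1,x_1),\dots,(a_K,x_K))$ with $K\in\mathbb N$, $a_j\in\mathbb R$, $x_j\in\mathcal X$; let $f_\theta=\sum_{j=1}^Ka_j\kappa(\cdot,x_j)$ and $C(\theta)=\sum_{i=1}^K\sum_{j=1}^Ka_ia_j\kappa(x_i,x_j)$. Let $R$ be the extended representation cost constructed from $(\Theta,f_\theta,C)$ in $\mathcal B=\mathrm{Lip}(\mathcal X)$. Then for any $f\in\mathrm{Lip}(\mathcal X)$, $$R(f)=\begin{cases}\|f\|_{\mathcal H}^2,&f\in\mathcal H,\\+\infty,&f\in\mathrm{Lip}(\mathcal X)\setminus\mathcal H.\end{cases}$$ In this case, the native space is $\mathcal F=\{f\in\mathrm{Lip}(\mathcal X):R(f)<+\infty\}=\mathcal H$.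
   Context: **Kernels.** A kernel is a symmetric function $\kappa:\mathcal X\times\mathcal X\to\mathbb R$ with $\sum_{i,j}a_ia_j\kappa(x_i,x_j)\ge0$ for all finite families. Its RKHS $\mathcal H$ is the unique Hilbert space of functions on $\mathcal X$ with $\kappa(x,\cdot)\in\mathcal H$ and $\langle\kappa(x,\cdot),f\rangle=f(x)$. $\kappa$ is $(L,\rho)$-Lipschitz if $\|\kappa(x,\cdot)-\kappa(z,\cdot)\|_{\mathcal H}\le L\rho(x,z)$ for all $x,z\in\mathcal X$ (this implies $\mathcal H\subset\mathrm{Lip}(\mathcal X)$). **Lipschitz space and weak\* topology.** $\mathrm{Lip}(\mathcal X)$ is the space of real Lipschitz functions on $\mathcal X$, with norm $\max\{|f|_{\mathrm{Lip}},|f(\mathrm e)|\}$, $|f|_{\mathrm{Lip}}=\sup_{x\neq y}|f(x)-f(y)|/\rho(x,y)$. The Arens–Eells space $\mathrm{AE}(\mathcal X)$ is the completion of the span of $\{\delta_x-\delta_y:x,y\in\mathcal X\}$ under $\|m\|=\inf\{\sum_i|a_i|\rho(x_i,y_i): m=\sum_ia_i(\delta_{x_i}-\delta_{y_i})\}$; it is the predual of the Lipschitz functions vanishing at $\mathrm e$, via $\langle\sum_ia_i(\delta_{x_i}-\delta_{y_i}),g\rangle=\sum_ia_i(g(x_i)-g(y_i))$. $\mathrm{Lip}(\mathcal X)$ is isometrically the dual of $\mathrm{AE}(\mathcal X)\oplus_1\mathbb R$, and $w^*$ is the corresponding weak\* topology: the coarsest topology making $f\mapsto\langle m,f-f(\mathrm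 e)\rangle$ ($m\in\mathrm{AE}(\mathcal X)$) and $f\mapsto f(\mathrm e)$ continuous. **Extended representation cost.** $R_\Theta(f)=\inf\{C(\theta):\theta\in\Theta,\ f_\theta=f\}$ for $f\in\mathrm{Lip}(\mathcal X)$ ($\inf\varnothing=+\infty$). $R$ is the $w^*$-l.s.c. regularization of $R_\Theta$, i.e. the largest $w^*$-lower semicontinuous function on $\mathrm{Lip}(\mathcal X)$ bounded above by $R_\Theta$ (lower semicontinuous: all sublevel sets $\{\cdot\le\alpha\}$, $\alpha\in\mathbb R$, closed). *)

(* Defs.v *)
From HB Require Import structures.
From mathcomp Require Import all_boot all_order all_algebra.
From mathcomp Require Import all_classical all_reals all_analysis.
Set Implicit Arguments.
Unset Strict Implicit.
Unset Printing Implicit Defensive.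
Import Order.TTheory GRing.Theory Num.Theory.
Import numFieldNormedType.Exports.
Local Open Scope classical_set_scope.
Local Open Scope ring_scope.

Definition separable (T : topologicalType) : Prop :=
  exists2 D : set T, countable D & dense D.

Definition cauchy_for (R : realType) (V : zmodType) (N : V -> R)
    (u : nat -> V) : Prop :=
  forall eps : R, 0 < eps ->
    exists n0 : nat, forall m n : nat, (n0 <= m)%N -> (n0 <= n)%N ->
      N (u m - u n) < eps.

Section lsc_regularization.
Context {R : realType} {T : topologicalType}.
Implicit Types F g : T -> \bar R.
Local Open Scope ereal_scope.

(* The library phrases lower semicontinuity pointwise; this is the
   characterization by closed sublevel sets. *)
Lemma lower_semicontinuous_closed_sublevel g :
  lower_semicontinuous g <-> forall a : R, closed [set x | g x <= a%:E].
Proof.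
rewrite lower_semicontinuousP; split => + a => /(_ a).
  by rewrite -openC; congr open; apply/seteqP; split=> x /=;
     rewrite ltNge => /negP.
by rewrite -closedC; congr closed; apply/seteqP; split=> x /=;
   rewrite leNgt => /negP.
Qed.

Definition lsc_minorants F : set (T -> \bar R) :=
  [set g | lower_semicontinuous g /\ forall x, g x <= F x].

Definition lsc_reg F : T -> \bar R :=
  fun x => ereal_sup [set g x | g in lsc_minorants F].

Lemma lsc_reg_minorant F : lsc_minorants F (lsc_reg F).
Proof.
split=> [x a /ereal_sup_gt[_ [g [glsc gF] <-] agx]|x].
  have [V xV Vg] := glsc x a agx; exists V => // y /Vg agy.
  by apply: (lt_le_trans agy); apply: ereal_sup_ubound; exists g.
by apply: ge_ereal_sup => _ [g [_ gF] <-].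
Qed.

Lemma lsc_reg_max F g : lsc_minorants F g -> forall x, g x <= lsc_reg F x.
Proof. by move=> Fg x; apply: ereal_sup_ubound; exists g. Qed.

End lsc_regularization.

Section arens_eells.
Context {R : realType} {X : metricType R}.
Implicit Types (s : seq (R * X * X)) (m g : X -> R).

(* The list of the (a_i, x_i, y_i) stands for
   \sum_i a_i (delta_(x_i) - delta_(y_i)), as a finitely supported function. *)
Definition molecule_of s : X -> R :=
  fun z => \sum_(p <- s) p.1.1 * ((z == p.1.2)%:R - (z == p.2)%:R).

Definition is_molecule m : Prop := exists s, molecule_of s = m.

Definition ae_norm m : R :=
  inf [set \sum_(p <- s) `|p.1.1| * mdist p.1.2 p.2
      | s in [set s | molecule_of s = m]].

(* The support of a molecule is finite, so this is a finite sum; see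
   [mol_pairingE] for its value on a combination of elementary molecules. *)
Definition mol_pairing m g : R := \sum_(x \in [set: X]) m x * g x.

Lemma mol_pairingE s g :
  mol_pairing (molecule_of s) g =
  \sum_(p <- s) p.1.1 * (g p.1.2 - g p.2).
Proof.
pose xs : seq X := undup (map (fun p => p.1.2) s ++ map (fun p => p.2) s).
have xsu : uniq xs by exact: undup_uniq.
have pt (x : X) : x \in xs -> \sum_(z <- xs) (z == x)%:R * g z = g x.
  move=> xxs; rewrite (bigD1_seq x)//= eqxx mul1r big1 ?addr0// => z /negPf ->.
  by rewrite mul0r.
have inxs (p : R * X * X) : p \in s -> (p.1.2 \in xs) && (p.2 \in xs).
  move=> ps; rewrite !mem_undup !mem_cat; apply/andP; split; apply/orP.
    by left; apply/mapP; exists p.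
  by right; apply/mapP; exists p.
rewrite /mol_pairing -(fsbig_widen [set` xs])//= -?fsbig_seq//.
  under eq_bigr do rewrite /molecule_of mulr_suml.
  rewrite exchange_big/= big_seq [RHS]big_seq.
  apply: eq_bigr => p /inxs/andP[x1 x2].
  under eq_bigr do rewrite -mulrA mulrBl.
  by rewrite -mulr_sumr sumrB !pt.
move=> z [_ /= /negP zxs].
rewrite /molecule_of big_seq big1 ?mul0r// => p /inxs/andP[x1 x2].
have /negPf -> : z != p.1.2 by apply: contraNneq zxs => ->.
have /negPf -> : z != p.2 by apply: contraNneq zxs => ->.
by rewrite subrr mulr0.
Qed.

(* Points of the completion are represented by Cauchy sequences of molecules.
   Distinct sequences may represent the same point; the pairing below with a
   Lipschitz function only depends on the point. *)
Record AE := MkAE {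
  ae_seq :> nat -> X -> R ;
  ae_seq_mol : forall n, is_molecule (ae_seq n) ;
  ae_seq_cauchy : cauchy_for ae_norm ae_seq }.

(* The limit exists when g is Lipschitz. *)
Definition ae_pairing (m : AE) g : R := limn (fun n => mol_pairing (m n) g).

End arens_eells.
Arguments AE {R} X.

Section lip.
Context {R : realType} {X : metricType R}.

Definition lipschitz_functions : set (X -> R) :=
  [set f | exists k : R, forall x y : X, `|f x - f y| <= k * mdist x y].

(* An alias of the subtype of Lipschitz functions: the subtype itself carries
   the topology of pointwise convergence, the alias carries the weak-star
   topology. The base point e is a parameter because the functionals defining
   that topology refer to it. *)
Definition Lip (e : X) : Type := set_type lipschitz_functions.

Section base_point.
Variable e : X.
HB.instance Definition _ := Choice.on (Lip e).

Definition lip_val (f : Lip e) : X -> R := \val f.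

Definition wstar_functional (i : option (AE X)) (f : Lip e) : R :=
  if i is Some m then ae_pairing m (fun x => lip_val f x - lip_val f e)
  else lip_val f e.

Definition wstar_topology : Type :=
  sup_topology (fun i : option (AE X) =>
    Topological.class (initial_topology (wstar_functional i))).
HB.instance Definition _ := Topological.on wstar_topology.
HB.instance Definition _ := Topological.copy (Lip e) wstar_topology.

Lemma wstar_functional_continuous i :
  continuous (wstar_functional i : Lip e -> R).
Proof.
move=> f; have /cvg_sup/(_ i) fi : (nbhs f : set_system (Lip e)) --> f by [].
by apply: cvg_trans (@initial_continuous _ _ (wstar_functional i) f);
   apply: cvg_app.
Qed.

Lemma wstar_coarsest (T : topologicalType) (h : T -> Lip e) :
  (forall i, continuous (wstar_functional i \o h)) -> continuous h.
Proof.
move=> hc t; apply/cvg_sup => i.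
by apply: (@continuous_comp_initial (Lip e) T R (wstar_functional i) h).
Qed.

Definition rep_cost (Theta : Type) (realize : Theta -> X -> R)
    (C : Theta -> R) (f : Lip e) : \bar R :=
  ereal_inf [set (C t)%:E | t in [set t | realize t = lip_val f]].

Definition ext_rep_cost (Theta : Type) (realize : Theta -> X -> R)
    (C : Theta -> R) : Lip e -> \bar R :=
  lsc_reg (rep_cost realize C).

Definition native_space (Theta : Type) (realize : Theta -> X -> R)
    (C : Theta -> R) : set (X -> R) :=
  [set lip_val f | f in [set f | (ext_rep_cost realize C f < +oo)%E]].

End base_point.
End lip.

Section rkhs.
Context {R : realType} {X : Type}.

Definition is_kernel (k : X -> X -> R) : Prop :=
  (forall x y, k x y = k y x) /\
  (forall (n : nat) (x : 'I_n -> X) (a : 'I_n -> R),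
     0 <= \sum_i \sum_j a i * a j * k (x i) (x j)).

(* The inner product is a total function on X -> R; only its values on the
   carrier are meaningful. *)
Record hilbert_function_space := HilbertFunctionSpace {
  hcarrier :> set (X -> R) ;
  hdot : (X -> R) -> (X -> R) -> R ;
  hnorm := fun f => Num.sqrt (hdot f f) ;
  hcarrier0 : hcarrier 0 ;
  hcarrier_lin : forall (a : R) f g,
    hcarrier f -> hcarrier g -> hcarrier (a *: f + g) ;
  hdotC : forall f g, hcarrier f -> hcarrier g -> hdot f g = hdot g f ;
  hdot_lin : forall (a : R) f g h,
    hcarrier f -> hcarrier g -> hcarrier h ->
    hdot (a *: f + g) h = a * hdot f h + hdot g h ;
  hdot_gt0 : forall f, hcarrier f -> f != 0 -> 0 < hdot f f ;
  hcomplete : forall u : nat -> X -> R,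
    (forall n, hcarrier (u n)) -> cauchy_for hnorm u ->
    exists2 f, hcarrier f & (fun n => hnorm (u n - f)) @ \oo --> (0 : R) }.

Definition is_rkhs (k : X -> X -> R) (H : hilbert_function_space) : Prop :=
  (forall x, hcarrier H (k x)) /\
  (forall x f, hcarrier H f -> hdot H (k x) f = f x).

End rkhs.
Arguments hilbert_function_space R X : clear implicits.

Definition lipschitz_kernel (R : realType) (X : metricType R)
    (k : X -> X -> R) (H : hilbert_function_space R X) (L : R) : Prop :=
  forall x z : X, hnorm H (k x - k z) <= L * mdist x z.

Section kernel_machines.
Context {R : realType} {X : Type} (k : X -> X -> R).

Definition kernel_realize (t : seq (R * X)) : X -> R :=
  fun z => \sum_(p <- t) p.1 * k z p.2.

Definition kernel_cost (t : seq (R * X)) : R :=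
  \sum_(p <- t) \sum_(q <- t) p.1 * q.1 * k p.2 q.2.

End kernel_machines.

(* Main.v *)
Require Import Defs.
From mathcomp Require Import all_boot all_order all_algebra.
From mathcomp Require Import all_classical all_reals all_analysis.
From mathcomp Require Import ring lra.
Set Implicit Arguments.
Unset Strict Implicit.
Unset Printing Implicit Defensive.
Import Order.TTheory GRing.Theory Num.Theory.
Import numFieldNormedType.Exports.
Local Open Scope classical_set_scope.
Local Open Scope ring_scope.

(** The cost [||.||_H^2] (with value [+oo] off [H]) is the supremum over all
    [theta] of [2 * sum_j a_j f(x_j) - C(theta)]: if this supremum is finite,
    then by the parallelogram identity the functions [f_theta] of a maximizing
    sequence are Cauchy in [H], and perturbing [theta] by one more center shows
    that their limit is [f]. Point evaluations are weak-star continuous, so this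
    supremum is weak-star lower semicontinuous, and it agrees with [C(theta)] at
    [f_theta]. Conversely the same maximizing sequence converges to [f] in [H],
    hence in the Lipschitz norm, hence weak-star, which bounds every lower
    semicontinuous minorant of the representation cost at [f] by [||f||_H^2]. *)

Lemma dist_le_cvgr {R : realType} (u c : nat -> R) (l : R) :
  (forall n, `|u n - l| <= c n) -> c @ \oo --> (0 : R) -> u @ \oo --> l.
Proof.
move=> uc /cvgrPdist_lt c0; apply/cvgrPdist_lt => eps /c0; apply: filterS => n.
rewrite sub0r normrN => /(le_lt_trans (ler_norm _)).
by rewrite distrC; apply: le_lt_trans.
Qed.

(** * Inner-product geometry of a Hilbert space of functions *)

Section hilbert_function_space_theory.
Context {R : realType} {X : Type} (H : hilbert_function_space R X).
Implicit Types f g h : X -> R.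

Lemma hcarrierD f g : hcarrier H f -> hcarrier H g -> hcarrier H (f + g).
Proof. by move=> Hf Hg; rewrite -(scale1r f); apply: hcarrier_lin. Qed.

Lemma hcarrierZ a f : hcarrier H f -> hcarrier H (a *: f).
Proof.
by move=> Hf; rewrite -(addr0 (a *: f)); apply: hcarrier_lin => //; apply: hcarrier0.
Qed.

Lemma hcarrierB f g : hcarrier H f -> hcarrier H g -> hcarrier H (f - g).
Proof. by move=> Hf Hg; rewrite -scaleN1r; apply/hcarrierD/hcarrierZ. Qed.

Lemma hdotDl f g h : hcarrier H f -> hcarrier H g -> hcarrier H h ->
  hdot H (f + g) h = hdot H f h + hdot H g h.
Proof. by move=> Hf Hg Hh; rewrite -[in LHS](scale1r f) hdot_lin// mul1r. Qed.

Lemma hdot0l h : hcarrier H h -> hdot H 0 h = 0.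
Proof.
move=> Hh; have H0 := hcarrier0 H.
by apply: (addrI (hdot H 0 h)); rewrite -hdotDl// !addr0.
Qed.

Lemma hdotZl a f h : hcarrier H f -> hcarrier H h ->
  hdot H (a *: f) h = a * hdot H f h.
Proof.
move=> Hf Hh; have H0 := hcarrier0 H.
by rewrite -(addr0 (a *: f)) hdot_lin// hdot0l// addr0.
Qed.

Lemma hdotBl f g h : hcarrier H f -> hcarrier H g -> hcarrier H h ->
  hdot H (f - g) h = hdot H f h - hdot H g h.
Proof.
move=> Hf Hg Hh; rewrite -scaleN1r hdotDl//; last exact: hcarrierZ.
by rewrite hdotZl// mulN1r.
Qed.

Lemma hdot_ge0 f : hcarrier H f -> 0 <= hdot H f f.
Proof.
move=> Hf; have [->|f0] := eqVneq f 0; first by rewrite hdot0l//; apply: hcarrier0.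
exact/ltW/hdot_gt0.
Qed.

Lemma hdotBB f g : hcarrier H f -> hcarrier H g ->
  hdot H (f - g) (f - g) = hdot H f f - 2 * hdot H f g + hdot H g g.
Proof.
move=> Hf Hg; have Hfg := hcarrierB Hf Hg.
rewrite hdotBl// (hdotC Hf Hfg) (hdotC Hg Hfg) !hdotBl// (hdotC Hg Hf).
ring.
Qed.

Lemma hnorm_ge0 f : 0 <= hnorm H f.
Proof. exact: sqrtr_ge0. Qed.

Lemma sqr_hnorm f : hcarrier H f -> hnorm H f ^+ 2 = hdot H f f.
Proof. by move=> Hf; rewrite sqr_sqrtr// hdot_ge0. Qed.

Lemma hnormB f g : hcarrier H f -> hcarrier H g ->
  hnorm H (f - g) = hnorm H (g - f).
Proof.
move=> Hf Hg; rewrite /hnorm !hdotBB// (hdotC Hg Hf); congr Num.sqrt; ring.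
Qed.

Lemma cauchy_schwarz f g : hcarrier H f -> hcarrier H g ->
  `|hdot H f g| <= hnorm H f * hnorm H g.
Proof.
move=> Hf Hg; have [->|g0] := eqVneq g 0.
  rewrite (hdotC Hf (hcarrier0 H)) hdot0l// normr0.
  by rewrite mulr_ge0// hnorm_ge0.
rewrite -(@ler_pXn2r _ 2)// ?nnegrE ?mulr_ge0 ?hnorm_ge0//.
rewrite exprMn !sqr_hnorm// real_normK ?num_real//.
have gg := hdot_gt0 Hg g0.
(* This [t] minimizes [||f - t g||^2]; nonnegativity of the minimum is the squared inequality. *)
set t := hdot H f g / hdot H g g.
have := hdot_ge0 (hcarrierB Hf (hcarrierZ t Hg)).
rewrite hdotBB//; last exact: hcarrierZ.
have Htg := hcarrierZ t Hg.
rewrite (hdotC Hf Htg) !hdotZl// (hdotC Hg Htg) hdotZl// (hdotC Hg Hf).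
rewrite /t; set b := hdot H f g; set c := hdot H g g in gg *; set a := hdot H f f.
have -> : a - 2 * (b / c * b) + b / c * (b / c * c) = a - b ^+ 2 / c.
  by field; rewrite gt_eqF.
by rewrite subr_ge0 ler_pdivrMr.
Qed.

(** Expand the square of [g + (f - g)] and bound the cross term by Cauchy-Schwarz. In this form it
    yields continuity of the norm. *)
Lemma hnorm_triangle f g : hcarrier H f -> hcarrier H g ->
  hnorm H f <= hnorm H g + hnorm H (f - g).
Proof.
move=> Hf Hg; have Hfg := hcarrierB Hf Hg.
rewrite -(@ler_pXn2r _ 2)// ?nnegrE ?addr_ge0 ?hnorm_ge0//.
rewrite sqrrD !sqr_hnorm//.
have -> : hdot H f f = hdot H g g + 2 * hdot H g (f - g) + hdot H (f - g) (f - g).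
  by rewrite hdotBB// (hdotC Hg Hfg) hdotBl//; ring.
rewrite lerD2r lerD2l -[leRHS]mulr_natl ler_wpM2l//.
exact: ler_normlW (cauchy_schwarz Hg Hfg).
Qed.

End hilbert_function_space_theory.

(** * Kernel machines and a variational formula for the squared RKHS norm *)

Section kernel_machines_theory.
Context {R : realType} {X : Type} (k : X -> X -> R).
Variable H : hilbert_function_space R X.
Hypothesis rkhsH : is_rkhs k H.
Implicit Types (t : seq (R * X)) (f g : X -> R).

Let Hk x : hcarrier H (k x). Proof. by case: rkhsH. Qed.
Let repr x f : hcarrier H f -> hdot H (k x) f = f x.
Proof. by case: rkhsH => _; apply. Qed.

(** For [f] in [H] this is the inner product of [f_t] with [f]; written with point values, it makes
    sense for every function [f]. *)
Definition kernel_eval t f : R := \sum_(p <- t) p.1 * f p.2.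

(** Both sides are the inner product of [k x] and [k y]. This matches [k z x], as used in
    [kernel_realize], with the representer [k x]. *)
Lemma kernel_sym x y : k x y = k y x.
Proof. by rewrite -(repr y (Hk x)) -(repr x (Hk y)) (hdotC (Hk y) (Hk x)). Qed.

Lemma kernel_realize_nil : kernel_realize k [::] = 0.
Proof. by apply/funext => z; rewrite /kernel_realize big_nil. Qed.

Lemma kernel_realize_cons p t :
  kernel_realize k (p :: t) = p.1 *: k p.2 + kernel_realize k t.
Proof.
by apply/funext => z; rewrite /kernel_realize big_cons kernel_sym.
Qed.

Lemma kernel_realize_cat t s :
  kernel_realize k (t ++ s) = kernel_realize k t + kernel_realize k s.
Proof. by apply/funext => z; rewrite /kernel_realize big_cat. Qed.

Definition kernel_scale (a : R) t := [seq (a * p.1, p.2) | p <- t].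

Lemma kernel_realize_scale a t :
  kernel_realize k (kernel_scale a t) = a *: kernel_realize k t.
Proof.
apply/funext => z; rewrite /kernel_realize big_map/= [RHS]mulr_sumr.
by apply: eq_bigr => p _; rewrite mulrA.
Qed.

Lemma kernel_eval_scale a t f :
  kernel_eval (kernel_scale a t) f = a * kernel_eval t f.
Proof.
rewrite /kernel_eval big_map/= mulr_sumr.
by apply: eq_bigr => p _; rewrite mulrA.
Qed.

Lemma kernel_eval_cat t s f :
  kernel_eval (t ++ s) f = kernel_eval t f + kernel_eval s f.
Proof. exact: big_cat. Qed.

Lemma hcarrier_realize t : hcarrier H (kernel_realize k t).
Proof.
elim: t => [|p t IHt]; first by rewrite kernel_realize_nil; apply: hcarrier0.
by rewrite kernel_realize_cons; apply: hcarrier_lin.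
Qed.

Lemma hdot_realize t f : hcarrier H f ->
  hdot H (kernel_realize k t) f = kernel_eval t f.
Proof.
move=> Hf; elim: t => [|p t IHt].
  by rewrite kernel_realize_nil hdot0l// /kernel_eval big_nil.
rewrite kernel_realize_cons hdot_lin ?IHt ?repr//; last exact: hcarrier_realize.
by rewrite /kernel_eval big_cons.
Qed.

Lemma hdot_realize_cost t :
  hdot H (kernel_realize k t) (kernel_realize k t) = kernel_cost k t.
Proof.
rewrite hdot_realize; last exact: hcarrier_realize.
apply: eq_bigr => p _; rewrite mulr_sumr.
by apply: eq_bigr => q _; rewrite mulrA.
Qed.

Definition dual_objective f t : R := 2 * kernel_eval t f - kernel_cost k t.

(** Completing the square: on [H], maximizing the objective amounts to approximating [f] by [f_t] in
    norm. *)
Lemma dual_objectiveE f t : hcarrier H f ->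
  dual_objective f t =
  hdot H f f - hdot H (kernel_realize k t - f) (kernel_realize k t - f).
Proof.
move=> Hf; have Ht := hcarrier_realize t.
by rewrite hdotBB// hdot_realize_cost hdot_realize// /dual_objective; ring.
Qed.

(* The parallelogram identity, [dual_objective f] being a concave quadratic with
   leading part [- ||f_theta||^2]. *)
Lemma dual_objective_midpoint f t s :
  hdot H (kernel_realize k t - kernel_realize k s)
         (kernel_realize k t - kernel_realize k s) =
  4 * dual_objective f (kernel_scale 2^-1 (t ++ s))
  - 2 * (dual_objective f t + dual_objective f s).
Proof.
have [Ht Hs] := (hcarrier_realize t, hcarrier_realize s).
have Hts := hcarrierD Ht Hs.
rewrite hdotBB// /dual_objective -!hdot_realize_cost.
rewrite kernel_eval_scale kernel_eval_cat kernel_realize_scale kernel_realize_cat.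
rewrite hdotZl//; last exact: hcarrierZ.
rewrite (hdotC Hts (hcarrierZ _ Hts)) hdotZl//.
rewrite hdotDl// (hdotC Ht Hts) (hdotC Hs Hts) !hdotDl// (hdotC Hs Ht).
by field.
Qed.

(** An added center changes the objective by a quadratic in its weight, whose linear coefficient is
    twice the residual of [f_t] at [x]. *)
Lemma dual_objective_cons f t x a :
  dual_objective f ((a, x) :: t) =
  dual_objective f t + 2 * a * (f x - kernel_realize k t x) - a ^+ 2 * k x x.
Proof.
have Ht := hcarrier_realize t; have Hx := Hk x.
have Hax := hcarrierZ a Hx.
have Haxt := hcarrierD Hax Ht.
rewrite /dual_objective -!hdot_realize_cost kernel_realize_cons/=.
rewrite /kernel_eval big_cons/= -/(kernel_eval t f).
rewrite hdotDl// (hdotC Hax Haxt) (hdotC Ht Haxt) !hdotDl// (hdotC Ht Hax).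
rewrite hdotZl// (hdotC Hx Hax) !hdotZl// !repr//.
ring.
Qed.

Lemma kernel_ge0 x : 0 <= k x x.
Proof. by rewrite -(repr x (Hk x)) hdot_ge0. Qed.

(* Compare with [(a, x) :: t], where [a = (f x - f_t x) / (k x x + 1)]; the [+ 1]
   avoids dividing by zero. *)
Lemma dual_objective_residual f M t x : (forall s, dual_objective f s <= M) ->
  (f x - kernel_realize k t x) ^+ 2 <= (k x x + 1) * (M - dual_objective f t).
Proof.
move=> fM; set d := f x - _; set c := k x x.
have c0 : 0 <= c := kernel_ge0 x.
have c1 : 0 < c + 1 by lra.
have := fM ((d / (c + 1), x) :: t); rewrite dual_objective_cons -/d -/c => dM.
rewrite mulrC -ler_pdivrMr//.
(* With [q = d / (c + 1)], the right-hand side is the gain [2 q d - q^2 c] from the added center,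
   minus [q^2]. Dropping [- q^2] leaves the gain, which [dM] bounds. *)
have -> : d ^+ 2 / (c + 1) =
    2 * (d / (c + 1)) * d - (d / (c + 1)) ^+ 2 * c
    - (d / (c + 1)) ^+ 2 * (c + 2 - c) + (d / (c + 1)) ^+ 2.
  by field; rewrite gt_eqF.
have := sqr_ge0 (d / (c + 1)); lra.
Qed.

(** Here [f] is an arbitrary function. A maximizing sequence has a limit [g] in [H] by completeness,
    and comparing pointwise limits identifies [g] with [f]. *)
Lemma dual_objective_bounded f M : (forall t, dual_objective f t <= M) ->
  hcarrier H f /\
  forall eps : R, 0 < eps -> exists t, hnorm H (kernel_realize k t - f) < eps.
Proof.
move=> fM; pose A := range (dual_objective f).
have supA : has_sup A.
  by split; [exists (dual_objective f [::]), [::]|exists M => _ [t _ <-]].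
pose S : R := sup A.
have fS t : dual_objective f t <= S by apply: sup_upper_bound => //; exists t.
have /choice[u uS] (n : nat) : exists t, S - n.+1%:R^-1 < dual_objective f t.
  by have [|_ [t _ <-] tS] := @sup_adherent _ A n.+1%:R^-1 _ supA; [|exists t].
pose v n := kernel_realize k (u n).
have Hv n : hcarrier H (v n) := hcarrier_realize (u n).
have smallS (eps : R) : 0 < eps ->
    exists n0 : nat, forall n : nat, (n0 <= n)%N -> n.+1%:R^-1 < eps.
  move=> e0; have [N _ NP] := @near_infty_natSinv_lt R (PosNum e0).
  by exists N => n Nn; exact: (NP n Nn).
have [|g Hg vg] := hcomplete Hv.
  move=> eps e0; have [|n0 n0P] := smallS (eps ^+ 2 / 4).
    by rewrite divr_gt0// exprn_gt0.
  exists n0 => m n mn0 nn0.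
  have sqr_lt (x : R) : 0 <= x -> x ^+ 2 < eps ^+ 2 -> x < eps.
    by move=> x0; rewrite ltr_pXn2r// ?nnegrE// ltW.
  apply: sqr_lt (hnorm_ge0 _ _) _.
  rewrite sqr_hnorm; last exact: hcarrierB.
  rewrite (dual_objective_midpoint f).
  (* Values within [a] and [b] of the supremum [S] give [||v_m - v_n||^2 < 4 S - 2 (2 S - a - b) = 2
     (a + b)], which explains the tolerance [eps ^+ 2 / 4]. *)
  have bound (a b c p q r : R) : a < c / 4 -> b < c / 4 ->
      S - a < p -> S - b < q -> r <= S -> 4 * r - 2 * (p + q) < c.
    by clear -a; lra.
  exact: bound (n0P m mn0) (n0P n nn0) (uS m) (uS n) (fS _).
(* The residual bound with [M = S] forces the values at each point to tend to those of [f]. *)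
have vfx x : v ^~ x @ \oo --> f x.
  apply/cvgrPdist_lt => eps e0; have c0 := kernel_ge0 x.
  have [|n0 n0P] := smallS (eps ^+ 2 / (k x x + 1)).
    by rewrite divr_gt0 ?exprn_gt0//; lra.
  exists n0 => // n /= n0n.
  rewrite -(@ltr_pXn2r _ 2)// ?nnegrE ?(ltW e0)// real_normK ?num_real//.
  apply: le_lt_trans (dual_objective_residual (u n) x fS) _.
  rewrite mulrC -ltr_pdivlMr; last lra.
  by apply: le_lt_trans (n0P n n0n); rewrite lerBlDr addrC -lerBlDr ltW.
(* Convergence in [H] implies pointwise convergence, by the reproducing property. *)
have vgx x : v ^~ x @ \oo --> g x.
  apply: (@dist_le_cvgr _ _ (fun n => hnorm H (k x) * hnorm H (v n - g))) => [n|].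
    have Hvg := hcarrierB (Hv n) Hg.
    have -> : v n x - g x = hdot H (k x) (v n - g) by rewrite repr.
    exact: cauchy_schwarz.
  by rewrite -(mulr0 (hnorm H (k x))); apply: cvgMr.
have <- : g = f by apply/funext => x; apply: (cvg_unique _ (vgx x) (vfx x)).
split=> // eps e0; move/cvgrPdist_lt : vg => /(_ _ e0)[n0 _ /(_ n0 (leqnn _))].
by rewrite /= sub0r normrN ger0_norm ?hnorm_ge0//; exists (u n0).
Qed.

(** For [f] in [H] the objective is bounded by [||f||^2], so density of the kernel machines is an
    instance of the maximizing-sequence argument. *)
Lemma hcarrier_dense f (eps : R) : hcarrier H f -> 0 < eps ->
  exists t, hnorm H (kernel_realize k t - f) < eps.
Proof.
move=> Hf; apply: (@dual_objective_bounded f (hdot H f f) _).2 => t.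
rewrite dual_objectiveE// gerBl hdot_ge0//.
by apply/hcarrierB => //; exact: hcarrier_realize.
Qed.

(** By density choose [f_t] close to [f]: the objective at [t] then falls short of [||f||^2] by an
    arbitrarily small amount. *)
Lemma dual_objective_le f a : (forall t, dual_objective f t <= a) ->
  hcarrier H f /\ hnorm H f ^+ 2 <= a.
Proof.
move=> fa; have [Hf fd] := dual_objective_bounded fa; split=> //.
apply/ler_addgt0Pr => eps e0; have [|t td] := fd (Num.sqrt eps).
  by rewrite sqrtr_gt0.
have Htf := hcarrierB (hcarrier_realize t) Hf.
have := fa t; rewrite dual_objectiveE// -!sqr_hnorm// lerBlDr => /le_trans; apply.
rewrite lerD2l -(sqr_sqrtr (ltW e0)).
by rewrite ler_pXn2r// ?nnegrE ?hnorm_ge0 ?sqrtr_ge0// ltW.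
Qed.

End kernel_machines_theory.

(** * The pairing of Arens-Eells elements with Lipschitz functions *)

Section arens_eells_theory.
Context {R : realType} {X : metricType R}.
Implicit Types (s : seq (R * X * X)) (m g h : X -> R).

Lemma molecule_of_cat s s' :
  molecule_of (s ++ s') = molecule_of s + molecule_of s'.
Proof. by apply/funext => z; rewrite /molecule_of big_cat. Qed.

Lemma molecule_of_opp s :
  molecule_of [seq (- p.1.1, p.1.2, p.2) | p <- s] = - molecule_of s.
Proof.
apply/funext => z; rewrite /molecule_of big_map /= [RHS]raddf_sum.
by apply: eq_bigr => p _; rewrite mulNr.
Qed.

Lemma is_moleculeB m m' : is_molecule m -> is_molecule m' -> is_molecule (m - m').
Proof.
by move=> [s <-] [s' <-]; eexists; rewrite -molecule_of_opp -molecule_of_cat.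
Qed.

Lemma mol_pairingBl m m' g : is_molecule m -> is_molecule m' ->
  mol_pairing (m - m') g = mol_pairing m g - mol_pairing m' g.
Proof.
move=> [s <-] [s' <-]; rewrite -molecule_of_opp -molecule_of_cat !mol_pairingE.
rewrite big_cat big_map /= -sumrN; congr (_ + _).
by apply: eq_bigr => p _; rewrite mulNr.
Qed.

Lemma mol_pairingBr m g h : is_molecule m ->
  mol_pairing m (fun x => g x - h x) = mol_pairing m g - mol_pairing m h.
Proof.
move=> [s <-]; rewrite !mol_pairingE -sumrB.
by apply: eq_bigr => p _; rewrite -mulrBr; congr (_ * _); ring.
Qed.

(** Each representation of [m] bounds the pairing by [c] times its total mass; [ae_norm] is the
    infimum of these masses. *)
Lemma mol_pairing_le m g c : is_molecule m -> 0 <= c ->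
  (forall x y, `|g x - g y| <= c * mdist x y) ->
  `|mol_pairing m g| <= c * ae_norm m.
Proof.
move=> [s ms] c0 gc.
have le s' : molecule_of s' = m ->
    `|mol_pairing m g| <= c * \sum_(p <- s') `|p.1.1| * mdist p.1.2 p.2.
  move=> <-; rewrite mol_pairingE; apply: le_trans (ler_norm_sum _ _ _) _.
  rewrite mulr_sumr; apply: ler_sum => p _; rewrite normrM mulrCA.
  by rewrite ler_wpM2l.
have [c_eq0|c1] := eqVneq c 0; first by have := le _ ms; rewrite c_eq0 !mul0r.
rewrite mulrC -ler_pdivrMr ?lt0r ?c1//; apply: lb_le_inf; first by eexists; exists s.
move=> _ [s' /= ms' <-]; rewrite ler_pdivrMr ?lt0r ?c1// mulrC; exact: le.
Qed.

Lemma ae_pairing_cvg (m : AE X) g : lipschitz_functions g ->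
  (fun n => mol_pairing (m n) g) @ \oo --> ae_pairing m g.
Proof.
move=> [c gc]; apply/cauchy_cvgP/cauchy_exP => eps eps0.
(* The given Lipschitz constant [c] may be zero or negative, so a positive one replaces it before
   dividing. *)
have c0 : 0 < `|c| + 1 by rewrite ltr_wpDl.
have [|n0 n0P] := @ae_seq_cauchy _ _ m (eps / (`|c| + 1)); first by rewrite divr_gt0.
exists (mol_pairing (m n0) g); exists n0 => // n /= n0n.
rewrite /ball/= -mol_pairingBl; [|exact: ae_seq_mol..].
apply: (@le_lt_trans _ _ ((`|c| + 1) * ae_norm (m n0 - m n))).
  apply: mol_pairing_le (ltW c0) _; first by apply: is_moleculeB; exact: ae_seq_mol.
  move=> x y; apply: le_trans (gc x y) _; rewrite ler_wpM2r ?mdist_ge0//.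
  by rewrite ler_wpDr// ler_norm.
by rewrite mulrC -ltr_pdivlMr// n0P.
Qed.

Lemma ae_pairingB (m : AE X) g h : lipschitz_functions g -> lipschitz_functions h ->
  lipschitz_functions (fun x => g x - h x) ->
  ae_pairing m (fun x => g x - h x) = ae_pairing m g - ae_pairing m h.
Proof.
move=> Lg Lh Lgh; apply: cvg_lim => //.
have -> : (fun n => mol_pairing (m n) (fun x => g x - h x)) =
    (fun n => mol_pairing (m n) g - mol_pairing (m n) h).
  by apply/funext => n; rewrite mol_pairingBr//; exact: ae_seq_mol.
by apply: cvgB; apply: ae_pairing_cvg.
Qed.

(** The constant [B] is uniform in [g], so each element of the predual acts continuously for the
    Lipschitz seminorm. It is the mass of a representation of one molecule far in the sequence, plus
    [1] for the Cauchy tail. *)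
Lemma ae_pairing_bound (m : AE X) : exists2 B : R, 0 <= B &
  forall g c, 0 <= c -> (forall x y, `|g x - g y| <= c * mdist x y) ->
    `|ae_pairing m g| <= c * B.
Proof.
have [n0 n0P] := @ae_seq_cauchy _ _ m 1 ltr01.
have [s ms] := ae_seq_mol m n0.
pose B := \sum_(p <- s) `|p.1.1| * mdist p.1.2 p.2.
have B0 : 0 <= B by apply: sumr_ge0 => p _; rewrite mulr_ge0// mdist_ge0.
exists (B + 1); first by rewrite addr_ge0.
move=> g c c0 gc.
have mg : (fun n => `|mol_pairing (m n) g| : R) @ \oo --> `|ae_pairing m g|.
  exact: cvg_norm (@ae_pairing_cvg m g (ex_intro _ c gc)).
apply: (cvgr_to_le mg _); exists n0 => // n /= n0n.
have -> : mol_pairing (m n) g = mol_pairing (m n0) g - mol_pairing (m n0 - m n) g.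
  by rewrite mol_pairingBl; [ring|exact: ae_seq_mol..].
apply: le_trans (ler_normB _ _) _; rewrite mulrDr; apply: lerD.
  rewrite -ms mol_pairingE; apply: le_trans (ler_norm_sum _ _ _) _.
  rewrite mulr_sumr; apply: ler_sum => p _; rewrite normrM mulrCA.
  by rewrite ler_wpM2l.
apply: le_trans (mol_pairing_le _ c0 gc) _.
  by apply: is_moleculeB; exact: ae_seq_mol.
by rewrite ler_wpM2l// ltW// n0P.
Qed.

End arens_eells_theory.

(** For fixed [t] the objective is an affine function of finitely many point values. *)
Lemma dual_objective_continuous {R : realType} {X : Type} (T : topologicalType)
    (k : X -> X -> R) (ev : T -> X -> R) (t : seq (R * X)) :
  (forall x, continuous (fun f => ev f x)) ->
  continuous (fun f => dual_objective k (ev f) t).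
Proof.
move=> evc f; apply: cvgB; last exact: cvg_cst.
apply: cvgMr; elim: t => [|p t IHt].
  have -> : (fun f => kernel_eval [::] (ev f)) = (fun=> 0).
    by apply/funext => g; rewrite /kernel_eval big_nil.
  by rewrite /kernel_eval big_nil; exact: cvg_cst.
have consE g : kernel_eval (p :: t) (ev g) = p.1 * ev g p.2 + kernel_eval t (ev g).
  by rewrite /kernel_eval big_cons.
rewrite consE; under eq_fun do rewrite consE.
by apply: cvgD => //; apply: cvgMr; exact: evc.
Qed.

(** * Weak-star continuity of evaluations and weak-star convergence *)

Section wstar_theory.
Context {R : realType} {X : metricType R} (e : X).
Implicit Types f : Lip e.

Definition lip_of (h : X -> R) (hlip : lipschitz_functions h) : Lip e :=
  exist _ h (mem_set hlip).

Lemma lipschitz_lip_val f : lipschitz_functions (lip_val f).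
Proof. exact: set_mem (valP f). Qed.

Lemma lipschitzB (g h : X -> R) : lipschitz_functions g -> lipschitz_functions h ->
  lipschitz_functions (fun x => g x - h x).
Proof.
move=> [a ga] [b hb]; exists (a + b) => x y; rewrite mulrDl.
have -> : g x - h x - (g y - h y) = (g x - g y) - (h x - h y) by ring.
exact: le_trans (ler_normB _ _) (lerD _ _).
Qed.

Lemma lipschitz_cst (c : R) : lipschitz_functions (fun _ : X => c).
Proof. by exists 0 => x y; rewrite subrr normr0 mul0r. Qed.

Lemma wstar_cvg (T : Type) (F : set_system T) (FF : Filter F) (h : T -> Lip e) f :
  (forall i, (wstar_functional i (h x) : R) @[x --> F] --> wstar_functional i f) ->
  h x @[x --> F] --> f.
Proof.
move=> hc; apply/cvg_sup => i U.
have /= -> := @nbhsE (initial_topology (@wstar_functional _ _ e i)) f.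
move=> [_ [[C oC <-] Cf] /filterS]; apply; apply: hc.
exact: open_nbhs_nbhs.
Qed.

Lemma ae_dirac_cauchy (x : X) :
  cauchy_for ae_norm (fun _ : nat => molecule_of [:: (1 : R, x, e)]).
Proof.
move=> eps eps0; exists 0%N => _ _ _ _; rewrite subrr.
apply: le_lt_trans eps0; apply: ge_inf.
  exists 0 => _ [s _ <-]; apply: sumr_ge0 => p _.
  by rewrite mulr_ge0// mdist_ge0.
exists [::]; last by rewrite big_nil.
by apply/funext => z; rewrite /molecule_of big_nil.
Qed.

(** The element [delta_x - delta_e] of the completion, as a constant sequence. *)
Definition ae_dirac (x : X) : AE X :=
  MkAE (fun _ => ex_intro _ [:: (1, x, e)] erefl) (ae_dirac_cauchy x).

Lemma ae_pairing_dirac x (g : X -> R) : ae_pairing (ae_dirac x) g = g x - g e.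
Proof.
rewrite /ae_pairing /= mol_pairingE big_seq1 mul1r.
exact: lim_cst.
Qed.

(** Write [f x] as [(f x - f e) + f e]: the first term is the pairing with [delta_x - delta_e], the
    second is the functional at the base point. *)
Lemma eval_continuous (x : X) : continuous (fun f => lip_val f x : R).
Proof.
have -> : (fun f => lip_val f x) = (fun f =>
    wstar_functional (Some (ae_dirac x)) f + wstar_functional None f).
  by apply/funext => f /=; rewrite ae_pairing_dirac subrr subr0 subrK.
move=> f; apply: (@continuousD _ _ (Lip e)).
  exact: (@wstar_functional_continuous _ _ e (Some (ae_dirac x)) f).
exact: (@wstar_functional_continuous _ _ e None f).
Qed.

(** Norm convergence in the Lipschitz space implies weak-star convergence: [ae_pairing_bound]
    controls the predual part, and the values at [e] the remaining functional. *)
Lemma wstar_cvg_lipschitz (u : nat -> Lip e) f (c : nat -> R) :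
  (forall n x y,
     `|(lip_val (u n) x - lip_val f x) - (lip_val (u n) y - lip_val f y)|
     <= c n * mdist x y) ->
  (forall n, 0 <= c n) -> c @ \oo --> (0 : R) ->
  (fun n => lip_val (u n) e) @ \oo --> lip_val f e ->
  u @ \oo --> f.
Proof.
move=> uf c0 cv ue; apply: wstar_cvg => -[m|] //=.
have [B B0 mB] := ae_pairing_bound m.
have cB : (fun n => c n * B) @ \oo --> (0 : R).
  by rewrite -(mul0r B); apply: cvgMl.
have Lc (h : Lip e) : lipschitz_functions (fun x => lip_val h x - lip_val h e).
  by apply: lipschitzB; [exact: lipschitz_lip_val|exact: lipschitz_cst].
apply: (dist_le_cvgr _ cB) => n; rewrite -ae_pairingB//; last exact: lipschitzB.
apply: mB => // x y; apply: le_trans (uf n x y).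
by rewrite le_eqVlt; apply/orP; left; apply/eqP; congr `|_|; ring.
Qed.

End wstar_theory.

(** * Identification of the extended cost with the squared RKHS norm *)

Section kernel_machine_cost.
Context {R : realType} {X : metricType R} (e : X) (k : X -> X -> R).
Variables (H : hilbert_function_space R X) (L : R).
Hypotheses (rkhsH : is_rkhs k H) (lipk : lipschitz_kernel k H L).
Implicit Types f : Lip e.

Let Hk x : hcarrier H (k x). Proof. by case: rkhsH. Qed.

(** Apply Cauchy-Schwarz to [h] and [k x - k y]. The absolute value of [L] keeps the Lipschitz
    constant nonnegative. *)
Lemma rkhs_lip_le h x y : hcarrier H h ->
  `|h x - h y| <= hnorm H h * `|L| * mdist x y.
Proof.
move=> Hh; have Hxy := hcarrierB (Hk x) (Hk y).
have -> : h x - h y = hdot H (k x - k y) h by rewrite hdotBl// !rkhsH.2.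
apply: le_trans (cauchy_schwarz Hxy Hh) _; rewrite mulrC -mulrA.
apply: ler_wpM2l; first exact: hnorm_ge0.
by apply: le_trans (lipk x y) _; rewrite ler_wpM2r ?mdist_ge0// ler_norm.
Qed.

Lemma hcarrier_lipschitz h : hcarrier H h -> lipschitz_functions h.
Proof. by move=> Hh; exists (hnorm H h * `|L|) => x y; exact: rkhs_lip_le. Qed.

Definition rkhs_cost f : \bar R :=
  if lip_val f \in hcarrier H then (hnorm H (lip_val f) ^+ 2)%:E else +oo%E.

Lemma rkhs_cost_ge f t : ((dual_objective k (lip_val f) t)%:E <= rkhs_cost f)%E.
Proof.
rewrite /rkhs_cost; case: ifPn => [/set_mem Hf|_]; last exact: leey.
rewrite lee_fin (dual_objectiveE rkhsH)// sqr_hnorm// gerBl hdot_ge0//.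
by apply: hcarrierB => //; exact: hcarrier_realize.
Qed.

Lemma rkhs_cost_lsc : lower_semicontinuous rkhs_cost.
Proof.
move=> f a af.
(* If no [t] pushed the objective above [a], then [f] would lie in [H] with squared norm at most
   [a]. The strict superlevel set for this [t] is the required neighborhood. *)
have [t a_lt] : exists t, a < dual_objective k (lip_val f) t.
  apply/not_existsP => fa.
  have [t|Hf fna] := @dual_objective_le _ _ _ _ rkhsH (lip_val f) a.
    by rewrite leNgt; apply/negP.
  by move: af; rewrite /rkhs_cost mem_set// lte_fin ltNge fna.
have ct : continuous (fun g : Lip e => dual_objective k (lip_val g) t : R).
  exact/dual_objective_continuous/eval_continuous.
exists [set g : Lip e | a < dual_objective k (lip_val g) t].
  exact: (cvgr_gt _ (ct f)).
by move=> g /= ag; apply: lt_le_trans (rkhs_cost_ge g t); rewrite lte_fin.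
Qed.

Lemma rkhs_cost_realize f t : kernel_realize k t = lip_val f ->
  rkhs_cost f = (kernel_cost k t)%:E.
Proof.
move=> tf; have Ht := hcarrier_realize rkhsH t.
by rewrite /rkhs_cost -tf mem_set// sqr_hnorm// (hdot_realize_cost rkhsH).
Qed.

Lemma rkhs_cost_minorant :
  lsc_minorants (rep_cost (kernel_realize k) (kernel_cost k)) rkhs_cost.
Proof.
split=> [|f]; first exact: rkhs_cost_lsc.
by apply: le_ereal_inf_tmp => _ [t /= tf <-]; rewrite (rkhs_cost_realize tf).
Qed.

(** Otherwise some [a] lies strictly between [||f||^2] and [g f], and [g] exceeds [a] on a weak-star
    neighborhood of [f]. Kernel machines approximating [f] enter it with cost below [a], a
    contradiction. *)
Lemma minorant_le_rkhs_cost (g : Lip e -> \bar R) f :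
  lsc_minorants (rep_cost (kernel_realize k) (kernel_cost k)) g ->
  (g f <= rkhs_cost f)%E.
Proof.
move=> [glsc gF]; rewrite /rkhs_cost; case: ifPn => [/set_mem Hf|_];
  last exact: leey.
rewrite leNgt; apply/negP => fg.
have [a [fa ag]] : exists a : R, hnorm H (lip_val f) ^+ 2 < a /\ (a%:E < g f)%E.
  case: (g f) fg => [r| |]//; rewrite ?lte_fin => fr.
    exists ((hnorm H (lip_val f) ^+ 2 + r) / 2); rewrite lte_fin.
    by rewrite !midf_lt.
  by exists (hnorm H (lip_val f) ^+ 2 + 1); rewrite ltrDl ltr01 ltry.
have [V Vf Vg] := glsc f a ag.
have /choice[u uP] (n : nat) : exists t,
    hnorm H (kernel_realize k t - lip_val f) < n.+1%:R^-1.
  exact: (hcarrier_dense rkhsH).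
have Hu n := hcarrier_realize rkhsH (u n).
pose v n := lip_of e (hcarrier_lipschitz (Hu n)).
have nrm : (fun n => hnorm H (kernel_realize k (u n) - lip_val f)) @ \oo --> (0 : R).
  apply: dist_le_cvgr (@cvg_harmonic R) => n.
  by rewrite subr0 ger0_norm ?hnorm_ge0// ltW.
(* The Lipschitz kernel turns convergence in [H] into convergence of Lipschitz seminorms; the
   reproducing property at [e] handles the base point. *)
have vf : v @ \oo --> f.
  apply: (@wstar_cvg_lipschitz _ _ _ v f
      (fun n => hnorm H (kernel_realize k (u n) - lip_val f) * `|L|)).
  - move=> n x y.
    exact: (@rkhs_lip_le (_ - lip_val f) x y (hcarrierB (Hu n) Hf)).
  - by move=> n; rewrite mulr_ge0// hnorm_ge0.
  - by rewrite -(mul0r `|L|); apply: cvgMl.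
  - apply: (@dist_le_cvgr _ _ (fun n => hnorm H (k e) *
        hnorm H (kernel_realize k (u n) - lip_val f))) => [n|].
      have Huf := hcarrierB (Hu n) Hf.
      have -> : lip_val (v n) e - lip_val f e =
          hdot H (k e) (kernel_realize k (u n) - lip_val f).
        by rewrite rkhsH.2.
      exact: cauchy_schwarz.
    by rewrite -(mulr0 (hnorm H (k e))); apply: cvgMr.
have cost : (fun n => hnorm H (kernel_realize k (u n)) ^+ 2 : R) @ \oo -->
    hnorm H (lip_val f) ^+ 2.
  rewrite expr2; under eq_fun do rewrite expr2.
  have nc : (fun n => hnorm H (kernel_realize k (u n))) @ \oo --> hnorm H (lip_val f).
    apply: (dist_le_cvgr _ nrm) => n; rewrite ler_norml lerBlDl.
    rewrite (hnorm_triangle (Hu n) Hf).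
    by rewrite lerNl opprB lerBlDl [X in _ + X]hnormB// hnorm_triangle.
  exact: cvgM.
have [n [Vn na]] : exists n, V (v n) /\ hnorm H (kernel_realize k (u n)) ^+ 2 < a.
  have : \forall n \near \oo, V (v n) /\ hnorm H (kernel_realize k (u n)) ^+ 2 < a.
    by apply: filterI; [exact: vf|exact: (cvgr_lt _ cost)].
  by move=> /(filter_ex)[n nP]; exists n.
(* At [v n] the minorant exceeds [a], yet it is at most the cost of the representation [u n], which
   is below [a]. *)
have := lt_le_trans (Vg _ Vn) (gF (v n)).
rewrite ltNge => /negP; apply; apply: (@le_trans _ _ (kernel_cost k (u n))%:E).
  by apply: ereal_inf_lbound; exists (u n).
by rewrite lee_fin -(hdot_realize_cost rkhsH) -sqr_hnorm// ltW.
Qed.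

Lemma ext_rep_cost_kernel f :
  ext_rep_cost (kernel_realize k) (kernel_cost k) f = rkhs_cost f.
Proof.
apply/eqP; rewrite eq_le; apply/andP; split; last first.
  exact: lsc_reg_max rkhs_cost_minorant f.
by apply: ge_ereal_sup => _ [g gm <-]; exact: minorant_le_rkhs_cost.
Qed.

End kernel_machine_cost.

Theorem theorem5p7 (R : realType) (X : metricType R) (sepX : separable X)
    (e : X) (k : X -> X -> R) (kerk : is_kernel k)
    (H : hilbert_function_space R X) (rkhsH : is_rkhs k H)
    (L : R) (lipk : lipschitz_kernel k H L) :
  (forall f : Lip e,
     ext_rep_cost (kernel_realize k) (kernel_cost k) f =
       (if lip_val f \in hcarrier H then (hnorm H (lip_val f) ^+ 2)%:E
        else +oo%E)) /\
  native_space e (kernel_realize k) (kernel_cost k) = hcarrier H.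
Proof.
split=> [f|]; first exact: (ext_rep_cost_kernel rkhsH lipk).
apply/seteqP; split=> [_ [f /= + <-]|h Hh].
  rewrite (ext_rep_cost_kernel rkhsH lipk) /rkhs_cost.
  by case: ifPn => [/set_mem|].
exists (lip_of e (hcarrier_lipschitz rkhsH lipk Hh)) => //=.
by rewrite (ext_rep_cost_kernel rkhsH lipk) /rkhs_cost mem_set// ltry.
Qed.
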